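(* Let $K$ be a positive integer, and let $(a(n))_{n\ge 1}$ be the sequence of rational numbers defined by the initial conditions $a(m)=1$ for $1\le m\le 2K+1$ and, for all $n\ge 2K+2$, by the recurrence $$a(n)\,a(n-(2K+1)) = a(n-1)\,a(n-2K)+a(n-K)+a(n-K-1).$$ Then $a(n)$ is an integer for every $n\ge 1$.
   Context: The recurrence determines $a(n)$ by dividing by $a(n-(2K+1))$, i.e. $a(n)=\bigl(a(n-1)a(n-2K)+a(n-K)+a(n-K-1)\bigr)/a(n-(2K+1))$. *)

(* Defs.v *)
From mathcomp Require Export all_boot all_order all_algebra.

(* Main.v *)
Require Import Defs.
From mathcomp Require Import all_boot all_order all_algebra.
From mathcomp Require Import zify ring lra.
Import Order.TTheory GRing.Theory Num.Theory.
Local Open Scope ring_scope.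

(** The quadratic relation says that the 2 x 2 minors of the infinite array
    [x (n + i + 2 K j)] are the sums [x (n + K) + x (n + K + 1)]. By condensation
    this makes its 3 x 3 minors [K]-periodic in [n], so that a linear relation
    [x (n + 6K) - x n = alpha x (n + 4K) - beta x (n + 2K)] holds with constant
    coefficients. Reflecting the initial block of ones extends the sequence to
    the left by [2K] terms; on the resulting window of [6K] terms every division
    is by 1, so these terms are odd integers, and comparing the first two
    instances of the linear relation gives [alpha = beta] and
    [2 alpha = odd - odd], so that [alpha] is an integer. *)

Definition quad_rec {F : fieldType} (K : nat) (x : nat -> F) : Prop :=
  forall n, x (n + 2 * K).+1 * x n
            = x (n + 2 * K)%N * x n.+1 + x (n + K)%N + x (n + K).+1.

Definition det3 {F : fieldType} (a0 a1 a2 b0 b1 b2 c0 c1 c2 : F) : F :=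
  a0 * (b1 * c2 - b2 * c1) - a1 * (b0 * c2 - b2 * c0) + a2 * (b0 * c1 - b1 * c0).

Definition minor3 {F : fieldType} (K : nat) (x : nat -> F) (n : nat) : F :=
  det3 (x n) (x n.+1) (x n.+2)
       (x (n + 2 * K)%N) (x (n + 2 * K).+1) (x (n + 2 * K).+2)
       (x (n + 4 * K)%N) (x (n + 4 * K).+1) (x (n + 4 * K).+2).

(** Desnanot-Jacobi identity around the central entry [b1]; the factors are ordered so that
    [quad_rec_minor] rewrites each 2 x 2 minor. *)
Lemma det3_condensation {F : fieldType} (a0 a1 a2 b0 b1 b2 c0 c1 c2 : F) :
  det3 a0 a1 a2 b0 b1 b2 c0 c1 c2 * b1
  = (b1 * a0 - b0 * a1) * (c2 * b1 - c1 * b2)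
    - (b2 * a1 - b1 * a2) * (c1 * b0 - c0 * b1).
Proof. by rewrite /det3; ring. Qed.

Lemma quad_rec_minor {F : fieldType} (K : nat) (x : nat -> F) (n : nat) :
  quad_rec K x ->
  x (n + 2 * K).+1 * x n - x (n + 2 * K)%N * x n.+1 = x (n + K)%N + x (n + K).+1.
Proof. by move=> ->; ring. Qed.

Lemma minor3_condensation {F : fieldType} (K : nat) (x : nat -> F) (n : nat) :
  quad_rec K x ->
  minor3 K x n * x (n + 2 * K).+1
  = (x (n + K)%N + x (n + K).+1) * (x (n + 3 * K).+1 + x (n + 3 * K).+2)
    - (x (n + K).+1 + x (n + K).+2) * (x (n + 3 * K)%N + x (n + 3 * K).+1).
Proof.
move=> hx; rewrite /minor3 det3_condensation.
have := quad_rec_minor K x n hx.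
have := quad_rec_minor K x n.+1 hx.
have := quad_rec_minor K x (n + 2 * K) hx.
have := quad_rec_minor K x (n + 2 * K).+1 hx.
have -> : (n + 2 * K + 2 * K = n + 4 * K)%N by lia.
have -> : (n + 2 * K + K = n + 3 * K)%N by lia.
rewrite !addSn.
have -> : (n + 2 * K + 2 * K = n + 4 * K)%N by lia.
have -> : (n + 2 * K + K = n + 3 * K)%N by lia.
by move=> -> -> -> ->.
Qed.

(** The two minors have central entries [x (n + 3 * K).+1] and [x (n + 2 * K).+1]. Multiplied by
    both, each reduces through the 2 x 2 relations to one polynomial in the terms near [n + 2 * K]
    and [n + 3 * K]. *)
Lemma minor3_shift {F : fieldType} (K : nat) (x : nat -> F) (n : nat) :
  quad_rec K x -> (forall m, x m != 0) -> minor3 K x (n + K) = minor3 K x n.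
Proof.
move=> hx x0.
have E0 := minor3_condensation K x n hx.
have E1 := minor3_condensation K x (n + K) hx.
have p0 := quad_rec_minor K x (n + K) hx.
have p1 := quad_rec_minor K x (n + K).+1 hx.
have b0 := quad_rec_minor K x (n + 2 * K) hx.
have b1 := quad_rec_minor K x (n + 2 * K).+1 hx.
have e2 : (n + K + K = n + 2 * K)%N by lia.
have e3 : (n + 2 * K + K = n + 3 * K)%N by lia.
have e3' : (n + K + 2 * K = n + 3 * K)%N by lia.
have e4 : (n + 2 * K + 2 * K = n + 4 * K)%N by lia.
have e4' : (n + K + 3 * K = n + 4 * K)%N by lia.
rewrite !addSn ?(e2, e3, e3', e4, e4') in E0 E1 p0 p1 b0 b1.
apply: (mulIf (x0 (n + 2 * K).+1)); apply: (mulIf (x0 (n + 3 * K).+1)).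
rewrite E0 mulrAC E1.
move: p0 p1 b0 b1.
move: (x (n + K)%N) (x (n + K).+1) (x (n + K).+2) => P0 P1 P2.
move: (x (n + 2 * K)%N) (x (n + 2 * K).+1) (x (n + 2 * K).+2) => B0 B1 B2.
move: (x (n + 3 * K)%N) (x (n + 3 * K).+1) (x (n + 3 * K).+2) => R0 R1 R2.
move: (x (n + 4 * K)%N) (x (n + 4 * K).+1) (x (n + 4 * K).+2) => C0 C1 C2.
move=> p0 p1 b0 b1.
(* Both sides equal this expression, symmetric under exchanging B and R. *)
transitivity ((R0 + R1) * (B1 + B2) + (R1 + R2) * (B0 + B1)).
  by rewrite -b0 -b1; ring.
by rewrite -p0 -p1; ring.
Qed.

Lemma quad_rec_linear {F : realFieldType} (K : nat) (x : nat -> F) :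
  quad_rec K x -> (forall m, 0 < x m) ->
  exists alpha beta : F, forall n,
    x (n + 6 * K)%N - x n = alpha * x (n + 4 * K)%N - beta * x (n + 2 * K)%N.
Proof.
move=> hx xpos.
have x0 m : x m != 0 by rewrite gt_eqF.
pose m n := x (n + 4 * K).+1 * x (n + 2 * K)%N - x (n + 4 * K)%N * x (n + 2 * K).+1.
have m0 n : m n != 0.
  have := quad_rec_minor K x (n + 2 * K) hx.
  have -> : (n + 2 * K + 2 * K = n + 4 * K)%N by lia.
  rewrite /m => ->.
  by rewrite gt_eqF // addr_gt0.
pose d i := x (i + 6 * K)%N - x i.
(* Cramer's rule for the instances [n = 0] and [n = 1], whose determinant is [m 0]. *)
pose alpha := (d 1%N * x (2 * K)%N - d 0%N * x (2 * K).+1) / m 0%N.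
pose beta := (d 1%N * x (4 * K)%N - d 0%N * x (4 * K).+1) / m 0%N.
exists alpha, beta => n.
suff [] : d n = alpha * x (n + 4 * K)%N - beta * x (n + 2 * K)%N /\
  d n.+1 = alpha * x (n + 4 * K).+1 - beta * x (n + 2 * K).+1 by [].
elim: n => [|n [IH0 IH1]].
  rewrite !add0n /alpha /beta.
  have := m0 0%N; rewrite /m !add0n => ?.
  by split; field.
split => //; apply: (mulIf (m0 n)); apply/eqP; rewrite -subr_eq0; apply/eqP.
(* Up to a cyclic permutation of rows, the two minors differ only in one row, so the determinant
   with rows [d], [x (_ + 2 * K)], [x (_ + 4 * K)] vanishes. As [m n] is nonzero, the relation
   passes from columns [n], [n.+1] to [n.+2]. *)
have D : minor3 K x (n + 2 * K) = minor3 K x n.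
  by rewrite mulSn mul1n addnA !minor3_shift.
have e4 : (n + 2 * K + 2 * K = n + 4 * K)%N by lia.
have e6 : (n + 2 * K + 4 * K = n + 6 * K)%N by lia.
rewrite /minor3 /det3 e4 e6 in D.
move: IH0 IH1; rewrite /d /m !addSn.
move/eqP; rewrite subr_eq => /eqP d0.
move/eqP; rewrite subr_eq => /eqP d1.
rewrite d0 d1 in D.
apply: (etrans _ (subrr (minor3 K x n))).
rewrite -[X in _ = X - _]D /minor3 /det3.
by ring.
Qed.

Lemma quad_rec_pos {F : realFieldType} (K : nat) (x : nat -> F) :
  (0 < K)%N -> quad_rec K x -> (forall m, (m <= 2 * K)%N -> x m = 1) ->
  forall n, 0 < x n.
Proof.
move=> K0 hx x1; elim/ltn_ind => n IH.
have [/x1 -> //|n2K] := leqP n (2 * K)%N.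
have := hx (n - (2 * K).+1)%N.
have -> : (n - (2 * K).+1 + 2 * K).+1 = n by lia.
set i := (n - _)%N => E.
rewrite -(pmulr_lgt0 _ (IH i _)); last by lia.
by rewrite E !addr_gt0 ?mulr_gt0 // IH; lia.
Qed.

(** Up to [4 * K + 1] the divisor lies in the initial block, and a product of two odd integers plus
    two odd integers is odd. *)
Lemma quad_rec_odd (K : nat) (x : nat -> rat) :
  (0 < K)%N -> quad_rec K x -> (forall m, (m <= 2 * K)%N -> x m = 1) ->
  forall n, (n <= (4 * K).+1)%N -> exists z : int, x n = (2 * z + 1)%:~R.
Proof.
move=> K0 hx x1; elim/ltn_ind => n IH n4K.
have [/x1 ->|n2K] := leqP n (2 * K)%N; first by exists 0.
have := hx (n - (2 * K).+1)%N.
have -> : (n - (2 * K).+1 + 2 * K).+1 = n by lia.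
rewrite [X in _ * X]x1 ?mulr1; last by lia.
have [||u ->] := IH (n - (2 * K).+1 + 2 * K)%N; try lia.
have [||v ->] := IH (n - (2 * K).+1).+1; try lia.
have [||w ->] := IH (n - (2 * K).+1 + K)%N; try lia.
have [||t ->] := IH (n - (2 * K).+1 + K).+1; try lia.
move=> ->; exists (2 * u * v + u + v + w + t + 1).
by ring.
Qed.

(* The terms are reflected about [K] and then shifted right by [2K], so that
   the extension to the left is again indexed by [nat]. *)
Definition reflect_extend {T : Type} (K : nat) (x : nat -> T) (n : nat) : T :=
  if (n < 2 * K)%N then x (4 * K - n)%N else x (n - 2 * K)%N.

(** From [2 * K] to [4 * K] both branches fall in the block of ones. *)
Lemma reflect_extend_le {F : fieldType} (K : nat) (x : nat -> F) (n : nat) :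
  (forall m, (m <= 2 * K)%N -> x m = 1) -> (n <= 4 * K)%N ->
  reflect_extend K x n = x (4 * K - n)%N.
Proof.
by rewrite /reflect_extend => x1 n4K; case: ltnP => // h; rewrite !x1 //; lia.
Qed.

Lemma reflect_extendD {T : Type} (K : nat) (x : nat -> T) (n : nat) :
  reflect_extend K x (n + 2 * K) = x n.
Proof. by rewrite /reflect_extend addnK ltnNge leq_addl. Qed.

Lemma reflect_extend_rec {F : fieldType} (K : nat) (x : nat -> F) :
  quad_rec K x -> (forall m, (m <= 2 * K)%N -> x m = 1) ->
  quad_rec K (reflect_extend K x).
Proof.
move=> hx x1 n; have [nK|nK] := ltnP n (2 * K).
  (* All indices are at most [4 * K] here, and the recurrence is invariant under reversing the order
     of its terms. *)
  rewrite !reflect_extend_le //; try lia.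
  have := hx (4 * K - (n + 2 * K).+1)%N.
  have -> : (4 * K - (n + 2 * K).+1 + 2 * K).+1 = (4 * K - n)%N by lia.
  have -> : (4 * K - (n + 2 * K).+1 + 2 * K = 4 * K - n.+1)%N by lia.
  have -> : (4 * K - (n + 2 * K).+1).+1 = (4 * K - (n + 2 * K))%N by lia.
  have -> : (4 * K - (n + 2 * K).+1 + K = 4 * K - (n + K).+1)%N by lia.
  have -> : (4 * K - (n + K).+1).+1 = (4 * K - (n + K))%N by lia.
  by rewrite mulrC => ->; ring.
rewrite -(subnK nK); move: (n - 2 * K)%N => j.
have -> : (j + 2 * K + K = j + K + 2 * K)%N by lia.
by rewrite -!addSn !reflect_extendD !addSn hx.
Qed.

Lemma quad_rec_int (K : nat) (x : nat -> rat) :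
  (0 < K)%N -> quad_rec K x -> (forall m, (m <= 2 * K)%N -> x m = 1) ->
  forall n, x n \is a Num.int.
Proof.
move=> K0 hx x1.
(* For [y], the instances 0 and 1 of the linear relation involve [x] only up to [4 * K + 1], the
   range of [quad_rec_odd]. *)
pose y := reflect_extend K x.
have ypos n : 0 < y n.
  by rewrite /y /reflect_extend; case: ifP => _; apply: (quad_rec_pos K).
have [al [be lin]] := quad_rec_linear K y (reflect_extend_rec K x hx x1) ypos.
have xodd := quad_rec_odd K x K0 hx x1.
have yD n : y (n + 2 * K)%N = x n by exact: reflect_extendD.
have y4 n : y (n + 4 * K)%N = x (n + 2 * K)%N.
  by rewrite -[in RHS]yD; congr y; lia.
have y6 n : y (n + 6 * K)%N = x (n + 4 * K)%N.
  by rewrite -[in RHS]yD; congr y; lia.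
have yle n : (n <= 4 * K)%N -> y n = x (4 * K - n)%N by exact: reflect_extend_le.
(* Instance 0: [y (6 * K)] and [y 0] are both [x (4 * K)], and the other two terms are 1. *)
have be_al : be = al.
  have := lin 0%N; rewrite y6 y4 yD yle // subn0 !add0n subrr !x1 // !mulr1.
  by move/esym/eqP; rewrite subr_eq0 => /eqP.
have x3 : x (2 * K).+1 = 3.
  have := hx 0%N; rewrite !add0n (x1 0%N) // (x1 1%N) ?(x1 K) ?(x1 K.+1) //;
    try lia.
  by rewrite (x1 (2 * K)%N) // !mulr1.
(* Instance 1 reads [x (4 * K).+1 - x (4 * K - 1) = 3 * al - al], a difference of odd integers. *)
have al_int : al \is a Num.int.
  have := lin 1%N; rewrite y6 y4 yD yle; last by lia.
  have [|u] := xodd (4 * K).+1; first by lia.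
  have [|v] := xodd (4 * K - 1)%N; first by lia.
  rewrite !add1n x3 be_al (x1 1%N); last by lia.
  move=> -> -> E.
  suff -> : al = (u - v)%:~R by exact: intr_int.
  by move: E; rewrite !intrD !rmorphM /= => E; lra.
suff yint n : y n \is a Num.int by move=> n; rewrite -yD.
elim/ltn_ind: n => n IH.
have [n6|n6] := ltnP n (6 * K).
  have xint m : (m <= 4 * K)%N -> x m \is a Num.int.
    by move=> m4; have [|z ->] := xodd m; [lia | exact: intr_int].
  by rewrite /y /reflect_extend; case: ltnP => h; apply: xint; lia.
have := lin (n - 6 * K)%N; rewrite subnK // be_al => /eqP.
rewrite subr_eq => /eqP ->.
by rewrite rpredD ?rpredB ?rpredM // IH //; lia.
Qed.

Theorem theorem1 (K : nat) (hK : (0 < K)%N) (a : nat -> rat)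
  (a_init : forall m : nat, (1 <= m <= 2 * K + 1)%N -> a m = 1)
  (a_rec : forall n : nat, (2 * K + 2 <= n)%N ->
     a n * a (n - (2 * K + 1))%N
       = a (n - 1)%N * a (n - 2 * K)%N + a (n - K)%N + a (n - K - 1)%N) :
  forall n : nat, (1 <= n)%N -> a n \is a Num.int.
Proof.
case=> // n _.
apply: (quad_rec_int K (fun i => a i.+1)) => // [i|m mK]; last by apply: a_init; lia.
have := a_rec (i + 2 * K).+2.
have -> : ((i + 2 * K).+2 - (2 * K + 1) = i.+1)%N by lia.
have -> : ((i + 2 * K).+2 - 1 = (i + 2 * K).+1)%N by lia.
have -> : ((i + 2 * K).+2 - 2 * K = i.+2)%N by lia.
have -> : ((i + 2 * K).+2 - K = (i + K).+2)%N by lia.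
have -> : ((i + K).+2 - 1 = (i + K).+1)%N by lia.
by move=> ->; [ring | lia].
Qed.
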